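(* Let $\mathbb{F}$ be a field, let $\mathcal{H}(0)$ be the unital associative $\mathbb{F}$-algebra with generators $A,B$ and relation $AB=I$, regarded as a Lie algebra under the commutator $[f,g]=fg-gf$, and let $\mathfrak{L}(0)$ be the Lie subalgebra of $\mathcal{H}(0)$ generated by $A,B$. Then $\mathfrak{L}(0)$ is a Lie ideal of $\mathcal{H}(0)$, and the quotient Lie algebra $\mathcal{H}(0)/\mathfrak{L}(0)$ is infinite-dimensional and one-step nilpotent.
   Context: $I$ denotes the multiplicative identity. $\mathcal{H}(0)$ is the case $q=0$ of the $q$-deformed Heisenberg algebra $\mathcal{H}(q)=\mathbb{F}\langle A,B\rangle/(AB-qBA-I)$. For a Lie algebra $\mathfrak{L}$ set $\mathfrak{L}^{(0)}=\mathfrak{L}$ and $\mathfrak{L}^{(p)}=[\mathfrak{L}^{(p-1)},\mathfrak{L}]$ (the span of all such brackets) for $p\ge 1$; $\mathfrak{L}$ is $p$-step nilpotent if $p$ is the smallest integer such that $\mathfrak{L}^{(p)}=0$. Thus a nonzero Lie algebra is one-step nilpotent if and only if all its brackets vanish. *)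

(* Defs.v *)
From HB Require Import structures.
From mathcomp Require Import all_boot all_algebra generic_quotient ring_quotient.
From mathcomp Require Import boolp classical_sets.
From mathcomp Require Import monalg.

Set Implicit Arguments.
Unset Strict Implicit.
Unset Printing Implicit Defensive.

Import GRing.Theory.
Local Open Scope classical_set_scope.
Local Open Scope quotient_scope.
Local Open Scope ring_scope.

Section Subspaces.
Context {F : fieldType} {V : lmodType F}.

Definition subspace (W : set V) : Prop :=
  W 0 /\ forall (c : F) (x y : V), W x -> W y -> W (c *: x + y).

Definition lspan (S : set V) : set V :=
  [set x | exists n (c : 'I_n -> F) (v : 'I_n -> V),
     (forall i, S (v i)) /\ x = \sum_(i < n) c i *: v i].

End Subspaces.

Definition finite_dimensional (F : fieldType) (V : lmodType F) : Prop :=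
  exists s : seq V, lspan [set` s] = [set: V].

(* ring_quotient needs a boolean predicate; [pred_of_subspace] mentions the
   proof [hW] so that the closure instance below can be inferred. *)
Section LmodQuotient.
Context {F : fieldType} {V : lmodType F} {W : set V}.

Definition pred_of_subspace (hW : subspace W) : {pred V} := fun x => `[< W x >].

Variable hW : subspace W.

Lemma pred_of_subspaceP x : reflect (W x) (x \in pred_of_subspace hW).
Proof. exact: asboolP. Qed.

Lemma subspaceB x y : W x -> W y -> W (x - y).
Proof. by move=> Wx Wy; rewrite addrC -scaleN1r; apply: hW.2. Qed.

Fact pred_of_subspace_zmod : zmod_closed (pred_of_subspace hW).
Proof.
split=> [|x y /pred_of_subspaceP Wx /pred_of_subspaceP Wy].
  exact/pred_of_subspaceP/hW.1.
exact/pred_of_subspaceP/subspaceB.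
Qed.

HB.instance Definition _ :=
  GRing.isZmodClosed.Build V (pred_of_subspace hW) pred_of_subspace_zmod.

Definition lmod_quot : Type := Quotient.quot (pred_of_subspace hW).
HB.instance Definition _ := GRing.Zmodule.on lmod_quot.
HB.instance Definition _ := Quotient.on lmod_quot.

Lemma lmod_quot_eqP (x y : V) :
  \pi_lmod_quot x = \pi_lmod_quot y <-> W (x - y).
Proof.
split=> [/eqP|h]; last apply/eqP.
  by rewrite -Quotient.idealrBE => /pred_of_subspaceP.
by rewrite -Quotient.idealrBE; apply/pred_of_subspaceP.
Qed.

Lemma repr_lmod_quot (x : V) : W (repr (\pi_lmod_quot x) - x).
Proof. by apply/lmod_quot_eqP; rewrite reprK. Qed.

Lemma lmod_quotD x y :
  \pi_lmod_quot (x + y) = \pi_lmod_quot x + \pi_lmod_quot y.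
Proof. exact: Quotient.pi_add. Qed.

Lemma lmod_quot0 : \pi_lmod_quot 0 = 0.
Proof.
by apply: (addIr (\pi_lmod_quot 0)); rewrite add0r -lmod_quotD addr0.
Qed.

Definition lmod_quot_scale (c : F) (x : lmod_quot) : lmod_quot :=
  \pi_lmod_quot (c *: repr x).

Lemma lmod_quot_scaleE c x :
  lmod_quot_scale c (\pi_lmod_quot x) = \pi_lmod_quot (c *: x).
Proof.
apply/lmod_quot_eqP; rewrite -scalerBr -[_ *: _]addr0.
by apply: hW.2; [exact: repr_lmod_quot|exact: hW.1].
Qed.

Fact lmod_quot_scaleA a b x :
  lmod_quot_scale a (lmod_quot_scale b x) = lmod_quot_scale (a * b) x.
Proof. by rewrite -[x]reprK (lmod_quot_scaleE b) !lmod_quot_scaleE scalerA. Qed.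

Fact lmod_quot_scale1 : left_id 1 lmod_quot_scale.
Proof. by move=> x; rewrite -[x]reprK lmod_quot_scaleE scale1r. Qed.

Fact lmod_quot_scaleDr : right_distributive lmod_quot_scale +%R.
Proof.
move=> c x y; rewrite -[x]reprK -[y]reprK -lmod_quotD !lmod_quot_scaleE.
by rewrite scalerDr lmod_quotD.
Qed.

Fact lmod_quot_scaleDl x : {morph lmod_quot_scale^~ x : a b / a + b}.
Proof.
by move=> a b; rewrite -[x]reprK !lmod_quot_scaleE scalerDl lmod_quotD.
Qed.

HB.instance Definition _ := GRing.Zmodule_isLmodule.Build F lmod_quot
  lmod_quot_scaleA lmod_quot_scale1 lmod_quot_scaleDr lmod_quot_scaleDl.

Lemma lmod_quotZ c x : \pi_lmod_quot (c *: x) = c *: \pi_lmod_quot x.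
Proof. by rewrite -[LHS]lmod_quot_scaleE. Qed.

End LmodQuotient.

Arguments lmod_quot {F V W} hW.

Section AlgebraQuotient.
Context {F : fieldType} {R : algType F}.

Definition alg_ideal (I : set R) : Prop :=
  subspace I /\ forall a x, I x -> I (a * x) /\ I (x * a).

Definition generated_ideal (S : set R) : set R := smallest alg_ideal S.

(* Unital MathComp algebras are nontrivial, hence the requirement that the
   ideal be proper. *)
Definition proper_alg_ideal (I : set R) : Prop := alg_ideal I /\ ~ I 1.

Lemma generated_ideal_ideal S : alg_ideal (generated_ideal S).
Proof.
split; [split|].
- by move=> I [[[? _] _] _].
- move=> c x y Sx Sy I [hI SI].
  by apply: hI.1.2; [exact: Sx|exact: Sy].
- move=> a x Sx; split=> I [hI SI].
  + by apply: (hI.2 a x _).1; exact: Sx.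
  + by apply: (hI.2 a x _).2; exact: Sx.
Qed.

Context {I : set R}.
Variable hI : proper_alg_ideal I.

Definition alg_quot : Type := lmod_quot hI.1.1.
HB.instance Definition _ := GRing.Lmodule.on alg_quot.
HB.instance Definition _ := Quotient.on alg_quot.

Definition alg_quot_mul (x y : alg_quot) : alg_quot :=
  \pi_alg_quot (repr x * repr y).

Lemma alg_quot_mulE x y :
  alg_quot_mul (\pi_alg_quot x) (\pi_alg_quot y) = \pi_alg_quot (x * y).
Proof.
apply/lmod_quot_eqP; set x' := repr _; set y' := repr _.
rewrite -[x' * y'](subrK (x * y')) -mulrBl -addrA -mulrBr.
rewrite -[X in X + _]scale1r; apply: hI.1.1.2.
  by apply: (hI.1.2 _ _ _).2; exact: repr_lmod_quot.
by apply: (hI.1.2 _ _ _).1; exact: repr_lmod_quot.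
Qed.

Fact alg_quot_mulA : associative alg_quot_mul.
Proof.
elim/quotW=> x; elim/quotW=> y; elim/quotW=> z.
by rewrite (alg_quot_mulE y) (alg_quot_mulE x y) !alg_quot_mulE mulrA.
Qed.

Fact alg_quot_mul1 : left_id (\pi_alg_quot 1) alg_quot_mul.
Proof. by elim/quotW=> x; rewrite alg_quot_mulE mul1r. Qed.

Fact alg_quot_mulr1 : right_id (\pi_alg_quot 1) alg_quot_mul.
Proof. by elim/quotW=> x; rewrite alg_quot_mulE mulr1. Qed.

Fact alg_quot_mulDl : left_distributive alg_quot_mul +%R.
Proof.
elim/quotW=> x; elim/quotW=> y; elim/quotW=> z.
by rewrite -lmod_quotD !alg_quot_mulE mulrDl lmod_quotD.
Qed.

Fact alg_quot_mulDr : right_distributive alg_quot_mul +%R.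
Proof.
elim/quotW=> x; elim/quotW=> y; elim/quotW=> z.
by rewrite -lmod_quotD !alg_quot_mulE mulrDr lmod_quotD.
Qed.

Fact alg_quot_1neq0 : \pi_alg_quot 1 != 0 :> alg_quot.
Proof.
apply/eqP; rewrite -(lmod_quot0 hI.1.1) => /lmod_quot_eqP.
by rewrite subr0; exact: hI.2.
Qed.

HB.instance Definition _ := GRing.Zmodule_isNzRing.Build alg_quot
  alg_quot_mulA alg_quot_mul1 alg_quot_mulr1
  alg_quot_mulDl alg_quot_mulDr alg_quot_1neq0.

Lemma alg_quotM x y :
  \pi_alg_quot (x * y) = \pi_alg_quot x * \pi_alg_quot y.
Proof. by rewrite -alg_quot_mulE. Qed.

Fact alg_quot_scaleAl (c : F) (x y : alg_quot) : c *: (x * y) = c *: x * y.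
Proof.
elim/quotW: x => x; elim/quotW: y => y; rewrite -alg_quotM.
by rewrite -!lmod_quotZ -alg_quotM scalerAl.
Qed.

HB.instance Definition _ :=
  GRing.Lmodule_isLalgebra.Build F alg_quot alg_quot_scaleAl.

Fact alg_quot_scaleAr (c : F) (x y : alg_quot) : c *: (x * y) = x * (c *: y).
Proof.
elim/quotW: x => x; elim/quotW: y => y; rewrite -alg_quotM.
by rewrite -!lmod_quotZ -alg_quotM scalerAr.
Qed.

HB.instance Definition _ :=
  GRing.Lalgebra_isAlgebra.Build F alg_quot alg_quot_scaleAr.

End AlgebraQuotient.

Arguments alg_quot {F R I} hI.

Section FreeAlgebra.
Context (F : fieldType) (X : choiceType).

Definition free_alg : Type := {malg F[{fmonom X}]}.
HB.instance Definition _ := GRing.Lalgebra.on free_alg.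

Fact free_alg_scaleAr (c : F) (x y : free_alg) : c *: (x * y) = x * (c *: y).
Proof.
suff C z : c%:MP * z = z * c%:MP :> {malg F[{fmonom X}]}.
  by rewrite -!mul_malgC mulrA C mulrA.
rewrite !malgM_def fgmulUg fgmulgU.
by apply: eq_bigr => k _; rewrite mul1m mulm1 mulrC.
Qed.

HB.instance Definition _ :=
  GRing.Lalgebra_isAlgebra.Build F free_alg free_alg_scaleAr.

Definition free_gen (x : X) : free_alg := << fmu x >>.

End FreeAlgebra.

HB.mixin Record isLieAlgebra (F : fieldType) L of GRing.Lmodule F L := {
  lie : L -> L -> L;
  lie_linearl : forall (c : F) (x y z : L),
    lie (c *: x + y) z = c *: lie x z + lie y z;
  lie_linearr : forall (c : F) (x y z : L),
    lie z (c *: x + y) = c *: lie z x + lie z y;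
  liexx : forall x : L, lie x x = 0;
  lie_jacobi : forall x y z : L,
    lie x (lie y z) + lie y (lie z x) + lie z (lie x y) = 0
}.

#[short(type="lieAlgType")]
HB.structure Definition LieAlgebra (F : fieldType) :=
  {L of isLieAlgebra F L & GRing.Lmodule F L}.

Section CommutatorLie.
Context {F : fieldType} (R : algType F).

Definition comm_lie : Type := R.
HB.instance Definition _ := GRing.Lmodule.on comm_lie.

Definition commutator (x y : R) : R := x * y - y * x.

Fact commutator_linearl (c : F) (x y z : R) :
  commutator (c *: x + y) z = c *: commutator x z + commutator y z.
Proof.
rewrite /commutator mulrDl mulrDr -scalerAl -scalerAr scalerBr opprD.
by rewrite addrACA.
Qed.

Fact commutator_linearr (c : F) (x y z : R) :
  commutator z (c *: x + y) = c *: commutator z x + commutator z y.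
Proof.
rewrite /commutator mulrDl mulrDr -scalerAl -scalerAr scalerBr opprD.
by rewrite addrACA.
Qed.

Fact commutatorxx (x : R) : commutator x x = 0.
Proof. exact: subrr. Qed.

Fact commutator_jacobi (x y z : R) :
  commutator x (commutator y z) + commutator y (commutator z x)
    + commutator z (commutator x y) = 0.
Proof.
rewrite /commutator !mulrBl !mulrBr !mulrA !opprB !addrA.
rewrite (ACl ((1*12)*(2*7)*(3*10)*(4*5)*(6*11)*(8*9))%AC) /=.
by rewrite !(subrr, addNr) !addr0.
Qed.

HB.instance Definition _ := isLieAlgebra.Build F comm_lie
  commutator_linearl commutator_linearr commutatorxx commutator_jacobi.

Lemma comm_lieE (x y : R) : lie (x : comm_lie) y = x * y - y * x :> R.
Proof. by []. Qed.

End CommutatorLie.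

Section LieTheory.
Context {F : fieldType} {L : lieAlgType F}.

Definition lie_subalgebra (M : set L) : Prop :=
  subspace M /\ forall x y, M x -> M y -> M (lie x y).

Definition lie_generated (S : set L) : set L := smallest lie_subalgebra S.

Definition lie_ideal (I : set L) : Prop :=
  subspace I /\ forall x y, I x -> I (lie x y).

Fixpoint lower_central (p : nat) : set L :=
  if p is p'.+1 then
    lspan [set z | exists x y, lower_central p' x /\ z = lie x y]
  else [set: L].

End LieTheory.

Arguments lower_central {F} L p.

Definition step_nilpotent (F : fieldType) (p : nat) (L : lieAlgType F) : Prop :=
  lower_central L p = [set 0] /\
  forall m, lower_central L m = [set 0] -> (p <= m)%N.

Section LieQuotient.
Context {F : fieldType} {L : lieAlgType F} {I : set L}.
Variable hI : lie_ideal I.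

Definition lie_quot : Type := lmod_quot hI.1.
HB.instance Definition _ := GRing.Lmodule.on lie_quot.
HB.instance Definition _ := Quotient.on lie_quot.

Definition lie_quot_lie (x y : lie_quot) : lie_quot :=
  \pi_lie_quot (lie (repr x) (repr y)).

Lemma lieDl (x y z : L) : lie (x + y) z = lie x z + lie y z.
Proof. by rewrite -{1}[x]scale1r lie_linearl scale1r. Qed.

Lemma lieDr (x y z : L) : lie z (x + y) = lie z x + lie z y.
Proof. by rewrite -{1}[x]scale1r lie_linearr scale1r. Qed.

Lemma lie_antisym (x y : L) : lie x y = - lie y x.
Proof.
apply/eqP; rewrite -addr_eq0; apply/eqP.
by have := liexx (x + y); rewrite lieDl !lieDr !liexx addr0 add0r.
Qed.

Lemma lie_ideall x y : I x -> I (lie y x).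
Proof.
move=> Ix; rewrite lie_antisym -scaleN1r -[_ *: _]addr0.
by apply: hI.1.2; [exact: hI.2|exact: hI.1.1].
Qed.

Lemma lie_quot_lieE x y :
  lie_quot_lie (\pi_lie_quot x) (\pi_lie_quot y) = \pi_lie_quot (lie x y).
Proof.
apply/lmod_quot_eqP; set x' := repr _; set y' := repr _.
have -> : lie x' y' - lie x y = 1 *: lie (x' - x) y' + lie x (y' - y).
  rewrite scale1r -{1}[x'](subrK x) lieDl -addrA; congr (_ + _).
  by rewrite -{1}[y'](subrK y) lieDr addrK.
apply: hI.1.2; first by apply: hI.2; exact: repr_lmod_quot.
by apply: lie_ideall; exact: repr_lmod_quot.
Qed.

Fact lie_quot_linearl (c : F) (x y z : lie_quot) :
  lie_quot_lie (c *: x + y) z = c *: lie_quot_lie x z + lie_quot_lie y z.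
Proof.
elim/quotW: x => x; elim/quotW: y => y; elim/quotW: z => z.
by rewrite -lmod_quotZ -lmod_quotD !lie_quot_lieE lie_linearl lmod_quotD lmod_quotZ.
Qed.

Fact lie_quot_linearr (c : F) (x y z : lie_quot) :
  lie_quot_lie z (c *: x + y) = c *: lie_quot_lie z x + lie_quot_lie z y.
Proof.
elim/quotW: x => x; elim/quotW: y => y; elim/quotW: z => z.
by rewrite -lmod_quotZ -lmod_quotD !lie_quot_lieE lie_linearr lmod_quotD lmod_quotZ.
Qed.

Fact lie_quotxx (x : lie_quot) : lie_quot_lie x x = 0.
Proof. by elim/quotW: x => x; rewrite lie_quot_lieE liexx lmod_quot0. Qed.

Fact lie_quot_jacobi (x y z : lie_quot) :
  lie_quot_lie x (lie_quot_lie y z) + lie_quot_lie y (lie_quot_lie z x)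
    + lie_quot_lie z (lie_quot_lie x y) = 0.
Proof.
elim/quotW: x => x; elim/quotW: y => y; elim/quotW: z => z.
rewrite (lie_quot_lieE x y) (lie_quot_lieE y z) (lie_quot_lieE z x).
by rewrite !lie_quot_lieE -!lmod_quotD lie_jacobi lmod_quot0.
Qed.

HB.instance Definition _ := isLieAlgebra.Build F lie_quot
  lie_quot_linearl lie_quot_linearr lie_quotxx lie_quot_jacobi.

Lemma lie_quotE x y :
  \pi_lie_quot (lie x y) = lie (\pi_lie_quot x) (\pi_lie_quot y).
Proof. by rewrite -lie_quot_lieE. Qed.

End LieQuotient.

Arguments lie_quot {F L I} hI.

Section H0.
Variable F : fieldType.

(* The two free generators are indexed by [bool]: [true] is A, [false] is B. *)
Definition H0_relations : set (free_alg F bool) :=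
  [set free_gen F true * free_gen F false - 1].

(* Sending both generators to 1 gives a character of the free algebra killing
   AB - 1; it shows that the ideal generated by AB - 1 is proper. *)
Definition free_aug_mon (m : {fmonom bool}) : F := 1.

Fact free_aug_mon_mmorphism : mmorphism free_aug_mon.
Proof. by split=> // x y; rewrite /free_aug_mon mulr1. Qed.

HB.instance Definition _ :=
  isMultiplicative.Build {fmonom bool} F free_aug_mon free_aug_mon_mmorphism.

Fact H0_ideal_proper : proper_alg_ideal (generated_ideal H0_relations).
Proof.
split; first exact: generated_ideal_ideal.
pose aug : {rmorphism {malg F[{fmonom bool}]} -> F} := mmap idfun free_aug_mon.
have aug0 : alg_ideal [set x : free_alg F bool | aug x = 0].
  split; [split|]=> /=.
  - exact: rmorph0.
  - move=> c x y x0 y0; rewrite -[c *: x]mul_malgC rmorphD rmorphM /=.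
    by rewrite x0 y0 mulr0 addr0.
  - by move=> a x x0; rewrite !rmorphM /= x0 mulr0 mul0r.
have h1 : H0_relations `<=` [set x : free_alg F bool | aug x = 0].
  move=> _ ->; rewrite /= rmorphB rmorphM rmorph1 /=.
  by rewrite /aug /= !mmapU /free_aug_mon !mulr1 subrr.
by move=> /(_ _ (conj aug0 h1)) /= /eqP; rewrite rmorph1 oner_eq0.
Qed.

Definition H0 : algType F := alg_quot H0_ideal_proper.

Definition H0_A : H0 := \pi_(alg_quot H0_ideal_proper) (free_gen F true).
Definition H0_B : H0 := \pi_(alg_quot H0_ideal_proper) (free_gen F false).

Lemma H0_AB : H0_A * H0_B = 1.
Proof.
rewrite -alg_quotM; apply/lmod_quot_eqP => I [_]; exact.
Qed.

Definition L0 : set (comm_lie H0) := 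
  @lie_generated F (comm_lie H0) [set H0_A; H0_B].

End H0.

Arguments H0 F : clear implicits.
Arguments L0 F _ : clear implicits.

(* Main.v *)
Require Import Defs.
From HB Require Import structures.
From mathcomp Require Import all_boot all_algebra.
From mathcomp Require Import generic_quotient boolp classical_sets.
From mathcomp Require Import finmap monalg.

(** The elements [e_ij = B^i (1 - BA) A^j] are matrix units: since [AB = 1],
    the idempotent [e = 1 - BA] satisfies [Ae = eB = 0].  Their span [M] is a
    two-sided ideal containing [[A,B] = e], so [H(0)/M] is commutative and
    [M] contains every commutator.  Conversely [M] lies in [L(0)], because
    [e A^(j+1) = [e A^j, A]], [B^(i+1) e = [B, B^i e]], and [[B^i e, e A^j]]
    is [e_ij], up to a multiple of [e].  Hence [L(0)] contains all commutators,
    which makes it an ideal with abelian quotient.  The homomorphism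
    [A |-> X, B |-> 1/X] to [F(X)] maps [L(0)] into the span of [X] and [1/X],
    so the classes of [A^2, A^3, ...] are linearly independent. *)

Set Implicit Arguments.
Unset Strict Implicit.
Unset Printing Implicit Defensive.

Import GRing.Theory.
Local Open Scope classical_set_scope.
Local Open Scope quotient_scope.
Local Open Scope ring_scope.

(** * Subspaces, spans and linear dependence *)

Section Subspace.
Context {F : fieldType} {V : lmodType F}.
Implicit Types (W S : set V).

Lemma subspaceD W x y : subspace W -> W x -> W y -> W (x + y).
Proof. by move=> hW Wx Wy; rewrite -[x]scale1r; apply: hW.2. Qed.

Lemma subspaceZ W c x : subspace W -> W x -> W (c *: x).
Proof. by move=> hW Wx; rewrite -[_ *: _]addr0; apply: hW.2 => //; apply: hW.1. Qed.

Lemma subspace_sum W (I : Type) (r : seq I) (f : I -> V) :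
  subspace W -> (forall i, W (f i)) -> W (\sum_(i <- r) f i).
Proof.
move=> hW Wf; elim/big_ind: _ => //; first exact: hW.1.
by move=> x y; apply: subspaceD.
Qed.

Lemma lspan_subset W S : subspace W -> S `<=` W -> lspan S `<=` W.
Proof.
move=> hW SW _ [n [c [v [Sv ->]]]].
by apply: subspace_sum => // i; apply/(subspaceZ _ hW)/SW.
Qed.

Lemma lspan_nil : lspan [set` [::]] = [set 0 : V].
Proof.
rewrite eqEsubset; split.
  apply: lspan_subset => //; split=> // c x y -> ->.
  by rewrite /= scaler0 addr0.
by move=> _ ->; exists 0%N, (fun=> 0), (fun=> 0); split=> [[]//|]; rewrite big_ord0.
Qed.

Lemma finite_dimensional_relation (f : nat -> V) :
  finite_dimensional V ->
  exists n (u : 'rV[F]_n), u != 0 /\ \sum_(i < n) u 0 i *: f i = 0.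
Proof.
move=> [s sV].
(* [lspan] allows families of any length with repetitions; [W] keeps one coefficient per position of
   [s], so that coordinates become matrix rows. *)
pose W := [set x : V | exists d : 'I_(size s) -> F, x = \sum_j d j *: s`_j].
have hW : subspace W.
  split; first by exists (fun=> 0); rewrite big1 // => j _; rewrite scale0r.
  move=> c _ _ [d ->] [d' ->]; exists (fun j => c * d j + d' j).
  rewrite scaler_sumr -big_split; apply: eq_bigr => j _ /=.
  by rewrite scalerDl scalerA.
have sW : [set` s] `<=` W.
  move=> x /= xs; have xs' : (index x s < size s)%N by rewrite index_mem.
  exists (fun j => (j == Ordinal xs')%:R).
  rewrite (bigD1 (Ordinal xs')) //= eqxx scale1r nth_index // big1 ?addr0 //.
  by move=> j /negPf ->; rewrite scale0r.
have Wf i : exists d : 'I_(size s) -> F, f i = \sum_j d j *: s`_j.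
  by apply: (lspan_subset hW sW); rewrite sV.
have [C fC] := choice Wf.
(* One more row than columns, so the left kernel is nonzero; any nonzero row of it is the relation
   sought. *)
pose M : 'M_((size s).+1, size s) := \matrix_(i, j) C i j.
exists (size s).+1, (nz_row (kermx M)); split.
  rewrite nz_row_eq0 -mxrank_eq0 mxrank_ker subn_eq0 -ltnNge ltnS.
  exact: rank_leq_col.
have /sub_kermxP := nz_row_sub (kermx M); move: (nz_row _) => u /rowP uM.
under eq_bigr do rewrite fC scaler_sumr.
rewrite exchange_big big1 //= => j _.
under eq_bigr do rewrite scalerA.
rewrite -scaler_suml; have := uM j; rewrite !mxE.
by under eq_bigr do rewrite mxE; move=> ->; rewrite scale0r.
Qed.

Lemma lspan_subspace S : subspace (lspan S).
Proof.
split; first by exists 0%N, (fun=> 0), (fun=> 0); split=> [[]//|]; rewrite big_ord0.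
move=> c _ _ [n [d [v [Sv ->]]]] [m [d' [w [Sw ->]]]].
exists (n + m)%N, (fun i => match split i with inl j => c * d j | inr j => d' j end),
  (fun i => match split i with inl j => v j | inr j => w j end); split.
  by move=> i; case: (split i).
rewrite big_split_ord scaler_sumr; congr (_ + _); apply: eq_bigr => i _.
  by rewrite -[lshift _ _]/(unsplit (inl i)) unsplitK scalerA.
by rewrite -[rshift _ _]/(unsplit (inr i)) unsplitK.
Qed.

Lemma subset_lspan S : S `<=` lspan S.
Proof.
move=> x Sx; exists 1%N, (fun=> 1), (fun=> x); split=> //.
by rewrite big_ord1 scale1r.
Qed.

End Subspace.

Lemma subspace_preimage (F : fieldType) (V W : lmodType F) (f : V -> W)
    (S : set W) :
  linear f -> subspace S -> subspace [set x | S (f x)].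
Proof.
move=> flin hS; split=> [|c x y Sx Sy] /=; last by rewrite flin; apply: hS.2.
suff -> : f 0 = 0 by exact: hS.1.
by apply: (addrI (f 0)); rewrite -{1}[f 0]scale1r -flin scaler0 !addr0.
Qed.

Lemma mull_linear (F : fieldType) (R : algType F) (a : R) : linear ( *%R a).
Proof. by move=> c x y; rewrite mulrDr scalerAr. Qed.

Lemma mulr_linear (F : fieldType) (R : algType F) (a : R) : linear ( *%R^~ a).
Proof. by move=> c x y; rewrite mulrDl scalerAl. Qed.

(** * Matrix units in an algebra generated by [A], [B] with [A * B = 1] *)

Section OneSidedInverse.
Context {F : fieldType} {R : algType F} (A B : R).
Hypothesis AB : A * B = 1.
(** Says that [A] and [B] generate [R] as an algebra, in the form of an induction on words that grow
    on the left. *)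
Hypothesis gen : forall W : set R, subspace W -> W 1 ->
  (forall x, W x -> W (A * x)) -> (forall x, W x -> W (B * x)) ->
  forall x, W x.

Let e := 1 - B * A.
Let M := lspan [set x | exists i j, x = B ^+ i * e * A ^+ j].

Let Ae : A * e = 0. Proof. by rewrite mulrBr mulr1 mulrA AB mul1r subrr. Qed.
Let eB : e * B = 0. Proof. by rewrite mulrBl mul1r -mulrA AB mulr1 subrr. Qed.
Let ee : e * e = e. Proof. by rewrite {1}/e mulrBl mul1r -mulrA Ae mulr0 subr0. Qed.

Let hM : subspace M := lspan_subspace _.

Let M_unit i j : M (B ^+ i * e * A ^+ j).
Proof. by apply: subset_lspan; exists i, j. Qed.

Let Me : M e.
Proof. by have := M_unit 0 0; rewrite !expr0 mulr1 mul1r. Qed.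

(** On matrix units, left multiplication by [A] lowers the row index and kills row 0, and by [B]
    raises it; on the right, [A] raises the column index and [B] lowers it, killing column 0. *)
Let MmulA x : M x -> M (A * x).
Proof.
apply: (lspan_subset (subspace_preimage (mull_linear A) hM)) => _ [[|i] [j ->]] /=.
  by rewrite !mulrA mulr1 Ae mul0r; apply: hM.1.
by rewrite exprS !mulrA AB mul1r.
Qed.

Let MmulB x : M x -> M (B * x).
Proof.
apply: (lspan_subset (subspace_preimage (mull_linear B) hM)) => _ [i [j ->]] /=.
by rewrite !mulrA -exprS.
Qed.

Let MmulrA x : M x -> M (x * A).
Proof.
apply: (lspan_subset (subspace_preimage (mulr_linear A) hM)) => _ [i [j ->]] /=.
by rewrite -!mulrA -exprSr !mulrA.
Qed.

Let MmulrB x : M x -> M (x * B).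
Proof.
apply: (lspan_subset (subspace_preimage (mulr_linear B) hM)) => _ [i [[|j] ->]] /=.
  by rewrite mulr1 -!mulrA eB mulr0; apply: hM.1.
by rewrite exprSr -!mulrA AB mulr1 mulrA.
Qed.

Let Mmulr x y : M x -> M (x * y).
Proof.
(* [x] stays general: the first letter of [y] is absorbed into [x]. *)
move: y x; apply: gen.
- split=> [x Mx|c y z My Mz x Mx]; first by rewrite mulr0; apply: hM.1.
  by rewrite mull_linear; apply: hM.2; [apply: My|apply: Mz].
- by move=> x; rewrite mulr1.
- by move=> y My x Mx; rewrite mulrA; apply/My/MmulrA.
- by move=> y My x Mx; rewrite mulrA; apply/My/MmulrB.
Qed.

Let commutatorMl a x y : commutator (a * x) y = a * commutator x y + commutator a y * x
  :> R.
Proof. by rewrite /commutator mulrBr mulrBl !mulrA addrA subrK. Qed.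

Let commutatorC a b : commutator a b = - commutator b a :> R.
Proof. by rewrite /commutator opprB. Qed.

(** [commutator _ y] is a derivation and [M] is an ideal, so word induction reduces everything to
    brackets of generators: first [[A, y]], then [[B, y]], then [[x, y]]. *)
Lemma commutator_matrix_units x y : M (commutator x y).
Proof.
have linl y' : linear (fun x' : R => commutator x' y').
  by move=> c x' z'; rewrite -commutator_linearl.
have comm1 y' : M (commutator 1 y').
  by rewrite /commutator mulr1 mul1r subrr; apply: hM.1.
have Mneg x' : M (- x') -> M x'.
  by move=> Mx; rewrite -[x']opprK -scaleN1r; apply: subspaceZ.
have MAB : M (commutator A B) by rewrite /commutator AB.
have McommA y' : M (commutator A y').
  apply/Mneg; rewrite -commutatorC; move: y'; apply: gen => //.
  - exact: subspace_preimage (linl A) hM.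
  - move=> x' Mx'; rewrite commutatorMl; apply: subspaceD; [done|exact: MmulA|].
    by rewrite /commutator subrr mul0r; apply: hM.1.
  - move=> x' Mx'; rewrite commutatorMl; apply: subspaceD; [done|exact: MmulB|].
    by apply: Mmulr; apply/Mneg; rewrite -commutatorC.
have McommB y' : M (commutator B y').
  apply/Mneg; rewrite -commutatorC; move: y'; apply: gen => //.
  - exact: subspace_preimage (linl B) hM.
  - move=> x' Mx'; rewrite commutatorMl; apply: subspaceD; [done|exact: MmulA|].
    exact: Mmulr.
  - move=> x' Mx'; rewrite commutatorMl; apply: subspaceD; [done|exact: MmulB|].
    by rewrite /commutator subrr mul0r; apply: hM.1.
move: x; apply: gen => //.
- exact: subspace_preimage (linl y) hM.
- move=> x' Mx'; rewrite commutatorMl; apply: subspaceD; [done|exact: MmulA|].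
  exact: Mmulr.
- move=> x' Mx'; rewrite commutatorMl; apply: subspaceD; [done|exact: MmulB|].
  exact: Mmulr.
Qed.

Lemma matrix_units_lie_generated :
  M `<=` @lie_generated F (comm_lie R) [set A; B].
Proof.
set L := lie_generated _.
have [hL Llie] : lie_subalgebra L.
  split; [split|].
  - by move=> N [[[? _] _] _].
  - move=> c x y Lx Ly N hN; apply: hN.1.1.2; [exact: Lx|exact: Ly].
  - move=> x y Lx Ly N hN; apply: hN.1.2; [exact: Lx|exact: Ly].
have Lcomm x y : L x -> L y -> L (x * y - y * x) by exact: Llie.
have LA : L A by move=> N [_]; apply; left.
have LB : L B by move=> N [_]; apply; right.
have Le : L e by rewrite /e -AB; apply: Lcomm.
have LeA j : L (e * A ^+ j).
  elim: j => [|j IH]; first by rewrite mulr1.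
  (* The subtracted 0 is rewritten as [A * e * A ^+ j], which exhibits the bracket of [e * A ^+ j]
     with [A]; the next claim does the same with [B ^+ i * e * B]. *)
  rewrite exprSr mulrA -[_ * A]subr0.
  rewrite -[X in _ - X](mul0r (A ^+ j)) -Ae -[A * e * _]mulrA.
  exact: Lcomm.
have LBe i : L (B ^+ i * e).
  elim: i => [|i IH]; first by rewrite mul1r.
  rewrite exprS -mulrA -[B * _]subr0.
  rewrite -[X in _ - X](mulr0 (B ^+ i)) -eB [X in _ - X]mulrA.
  exact: Lcomm.
(* This product is [e] when [i = j] and 0 otherwise. *)
have LeABe i j : L (e * A ^+ j * (B ^+ i * e)).
  elim: i j => [|i IH] [|j].
  - by rewrite mulr1 mul1r ee.
  - by rewrite mul1r exprSr -!mulrA Ae !mulr0; apply: hL.1.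
  - by rewrite mulr1 exprS !mulrA eB !mul0r; apply: hL.1.
  - by rewrite exprSr exprS !mulrA -(mulrA _ A) AB mulr1 -mulrA; apply: IH.
apply: lspan_subset => // _ [i [j ->]].
(* Since [e] is idempotent, the matrix unit is [(B ^+ i * e) * (e * A ^+ j)]: a bracket plus the
   product in reverse order. *)
rewrite -ee mulrA -[_ * e * A ^+ j]mulrA.
rewrite -[X in L X](subrK (e * A ^+ j * (B ^+ i * e))).
by apply: (subspaceD hL); [apply: Lcomm|apply: LeABe].
Qed.

End OneSidedInverse.

(** * Induction on words in the free algebra *)

Lemma free_monom_mul (F : fieldType) (X : choiceType) (k1 k2 : {fmonom X}) :
  << mmul k1 k2 >> = (<< k1 >> : free_alg F X) * << k2 >>.
Proof. by rewrite [RHS]malgM_def fgmulUU mulr1. Qed.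

Lemma free_monomZ (F : fieldType) (X : choiceType) (c : F) (k : {fmonom X}) :
  << c *g k >> = c *: (<< k >> : free_alg F X).
Proof. by rewrite -[RHS]mul_malgC malgM_def fgmulUU mulr1 mul1m. Qed.

Lemma free_alg_ind (F : fieldType) (X : choiceType) (W : set (free_alg F X)) :
  subspace W -> W 1 -> (forall a x, W x -> W (free_gen F a * x)) ->
  forall x, W x.
Proof.
move=> hW W1 Wgen x.
have Wmon (m : {fmonom X}) : W (<< m >> : {malg F[{fmonom X}]}).
  case: m => s; elim: s => [|a s IH].
    suff -> : FMonom [::] = mone :> {fmonom X} by [].
    by apply/val_inj; rewrite /= fm1.
  suff -> : FMonom (a :: s) = mmul (fmu a) (FMonom s) by rewrite free_monom_mul; apply: Wgen.
  by apply/val_inj; rewrite /= fmM fmU.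
rewrite (monalgE x); apply: subspace_sum => // k.
rewrite free_monomZ; exact: (subspaceZ _ hW).
Qed.

(** * The homomorphism to [F(X)] and the powers of [A] modulo L(0) *)

Section Laurent.
Context (F : fieldType).

Notation K := {fraction {poly F}}.
Notation pi0 := (\pi_(alg_quot (H0_ideal_proper F))).

(** Discharges [gen] for H(0), by lifting [W] to the free algebra. *)
Lemma H0_ind (W : set (H0 F)) :
  subspace W -> W 1 ->
  (forall x, W x -> W (H0_A F * x)) -> (forall x, W x -> W (H0_B F * x)) ->
  forall x, W x.
Proof.
move=> hW W1 WA WB; elim/quotW; apply: free_alg_ind.
- apply: (subspace_preimage _ hW) => c x y.
  by rewrite lmod_quotD lmod_quotZ.
- exact: W1.
- by move=> [] x; rewrite alg_quotM; [apply: WA|apply: WB].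
Qed.

Lemma commutator_L0 (x y : H0 F) : L0 F (commutator x y).
Proof.
apply: (matrix_units_lie_generated (H0_AB F)).
exact: (commutator_matrix_units (H0_AB F) H0_ind).
Qed.

Definition laurent_var : K := tofrac 'X.

Lemma laurent_var_neq0 : laurent_var != 0.
Proof. by rewrite tofrac_eq0 polyX_eq0. Qed.

Definition laurent_mon (m : {fmonom bool}) : K :=
  \prod_(b <- (m : seq bool)) (if b then laurent_var else laurent_var^-1).

Fact laurent_mon_mmorphism : mmorphism laurent_mon.
Proof.
split=> [x y|]; rewrite /laurent_mon; first by rewrite fmM big_cat.
by rewrite fm1 big_nil.
Qed.

HB.instance Definition _ :=
  isMultiplicative.Build {fmonom bool} K laurent_mon laurent_mon_mmorphism.

Definition laurent_coef : {rmorphism F -> K} := @tofrac {poly F} \o polyC.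

(** The map of the overview, kept on the free algebra; [laurent_kernel] shows that it factors
    through H(0). *)
Definition laurent : {rmorphism free_alg F bool -> K} :=
  (mmap laurent_coef laurent_mon : {rmorphism {malg F[{fmonom bool}]} -> K}).

Lemma laurentZ c (x : free_alg F bool) :
  laurent (c *: x) = tofrac c%:P * laurent x.
Proof. exact: mmapZ. Qed.

Lemma laurent_gen b :
  laurent (free_gen F b) = if b then laurent_var else laurent_var^-1.
Proof.
rewrite -[LHS]/(mmap laurent_coef laurent_mon << fmu b >>) mmapU.
rewrite [X in X * _](rmorph1 laurent_coef) mul1r.
by rewrite /laurent_mon fmU big_seq1.
Qed.

Lemma laurent_kernel (x : free_alg F bool) :
  generated_ideal (@H0_relations F) x -> laurent x = 0.
Proof.
suff h : alg_ideal [set x : free_alg F bool | laurent x = 0] /\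
    @H0_relations F `<=` [set x : free_alg F bool | laurent x = 0].
  by move=> /(_ _ h).
split; last first.
  move=> _ ->; rewrite /= rmorphB rmorphM rmorph1 !laurent_gen.
  by rewrite divff ?subrr // laurent_var_neq0.
split; first split.
- exact: rmorph0.
- by move=> c x' y x0 y0 /=; rewrite rmorphD laurentZ x0 y0 mulr0 addr0.
- by move=> a x' x0; rewrite /= !rmorphM x0 mulr0 mul0r.
Qed.

Lemma laurent_L0 (x : free_alg F bool) : L0 F (pi0 x) ->
  exists a b : F, laurent x = tofrac a%:P * laurent_var + tofrac b%:P / laurent_var.
Proof.
(* [N] consists of the classes having some lift with image in the span of [X] and [1/X]; it is a Lie
   subalgebra containing both generators. *)
pose N := [set h : H0 F | exists a b (x : free_alg F bool), pi0 x = h /\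
  laurent x = tofrac a%:P * laurent_var + tofrac b%:P / laurent_var].
have hN : @lie_subalgebra F (comm_lie (H0 F)) N.
  split; [split|].
  - exists 0, 0, 0; split; first exact: lmod_quot0.
    by rewrite rmorph0 !mul0r addr0.
  - move=> c _ _ [a [b [y [<- ly]]]] [a' [b' [y' [<- ly']]]].
    exists (c * a + a'), (c * b + b'), (c *: y + y'); split.
      by rewrite lmod_quotD lmod_quotZ.
    rewrite rmorphD laurentZ ly ly' !polyCD !polyCM !rmorphD !rmorphM /=.
    by rewrite mulrDr !mulrDl !mulrA addrACA.
  (* [F(X)] is commutative, so a commutator has image 0. *)
  - move=> _ _ [a [b [y [<- _]]]] [a' [b' [y' [<- _]]]].
    exists 0, 0, (y * y' - y' * y); split.
      by rewrite lmod_quotD -scaleN1r lmod_quotZ !alg_quotM scaleN1r.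
    by rewrite rmorphB !rmorphM mulrC subrr !mul0r addr0.
have LN : L0 F `<=` N.
  move=> h; apply; split=> // _ [->|->].
    exists 1, 0, (free_gen F true); split=> //.
    by rewrite laurent_gen rmorph1 rmorph0 mul1r mul0r addr0.
  exists 0, 1, (free_gen F false); split=> //.
  by rewrite laurent_gen rmorph1 rmorph0 mul0r add0r mul1r.
(* The lift [y] given by [N] differs from [x] by an element of the ideal, so both have the same
   image. *)
move=> /LN [a [b [y [/lmod_quot_eqP/laurent_kernel]]]].
by rewrite rmorphB => /subr0_eq -> ->; exists a, b.
Qed.

Lemma L0_A_powers n (u : 'rV[F]_n) :
  L0 F (\sum_(i < n) u 0 i *: H0_A F ^+ i.+2) -> u = 0.
Proof.
pose x : free_alg F bool := \sum_(i < n) u 0 i *: free_gen F true ^+ i.+2.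
have piX i : pi0 (free_gen F true ^+ i) = H0_A F ^+ i.
  by elim: i => // i IH; rewrite !exprS alg_quotM IH.
have -> : \sum_(i < n) u 0 i *: H0_A F ^+ i.+2 = pi0 x.
  rewrite /x (big_morph _ (@lmod_quotD _ _ _ _) (lmod_quot0 _)).
  by apply: eq_bigr => i _; rewrite lmod_quotZ piX.
have lx : laurent x = tofrac (\sum_(i < n) u 0 i *: 'X^(i.+2)).
  rewrite !rmorph_sum; apply: eq_bigr => i _.
  by rewrite laurentZ rmorphXn laurent_gen -mul_polyC rmorphM rmorphXn.
(* Multiplying by [X] clears the denominator: the sum of the [u_i X^(i+3)] equals [a X^2 + b]. *)
move=> /laurent_L0 [a [b]]; rewrite lx => /(congr1 (fun z => z * laurent_var)).
rewrite mulrDl divfK ?laurent_var_neq0 // -!rmorphM -rmorphD /=.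
move/eqP; rewrite tofrac_eq => /eqP/polyP pE.
(* The coefficient in degree [i + 3] isolates [u_i] on the left and is 0 on the right, whose degree
   is at most 2. *)
apply/rowP => i; have := pE i.+3.
rewrite mulr_suml coef_sum (bigD1 i) //= big1 => [|j ji].
  rewrite -scalerAl -exprSr coefZ coefXn eqxx mulr1 addr0 mxE => ->.
  by rewrite coefD -mulrA -expr2 coefCM coefXn mulr0 coefC addr0.
rewrite -scalerAl -exprSr coefZ coefXn !eqSS eq_sym.
by rewrite -[_ == _ :> nat]/(j == i) (negPf ji) mulr0.
Qed.

End Laurent.

(** * The quotient H(0)/L(0) *)

Theorem theorem4p10 (F : fieldType) :
  exists hI : lie_ideal (L0 F),
    ~ finite_dimensional (lie_quot hI) /\ step_nilpotent 1 (lie_quot hI).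
Proof.
have hI : lie_ideal (L0 F).
  split=> [|x y _]; last exact: commutator_L0.
  split=> [N [[[? _] _] _] //|c x y Lx Ly N hN].
  by apply: hN.1.1.2; [exact: Lx|exact: Ly].
exists hI.
have infdim : ~ finite_dimensional (lie_quot hI).
  move=> /(finite_dimensional_relation
    (fun i => \pi_(lie_quot hI) (H0_A F ^+ i.+2))) [n [u [/eqP u0 uE]]].
  (* A relation between the classes of the powers of [A] says that the same combination in H(0) lies
     in L(0). *)
  apply/u0/L0_A_powers; rewrite -[X in L0 F X]subr0.
  apply/(lmod_quot_eqP hI.1); rewrite lmod_quot0 -[RHS]uE.
  rewrite (big_morph _ (@lmod_quotD _ _ _ hI.1) (lmod_quot0 _)).
  by apply: eq_bigr => i _; rewrite lmod_quotZ.
split=> //; split=> [|[|m] // LT].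
  have lie0 (x y : lie_quot hI) : lie x y = 0.
    elim/quotW: x => x; elim/quotW: y => y; rewrite -lie_quotE.
    rewrite -(lmod_quot0 hI.1); apply/lmod_quot_eqP.
    by rewrite subr0; apply: commutator_L0.
  rewrite eqEsubset; split=> [|_ ->] /=; last exact: (lspan_subspace _).1.
  apply: lspan_subset => [|_ [x [y [_ ->]]]]; last exact: lie0.
  by split=> // c x y -> ->; rewrite /= scaler0 addr0.
(* The remaining case is [m = 0], where the whole quotient would be zero and hence spanned by the
   empty list. *)
by case: infdim; exists [::]; rewrite lspan_nil.
Qed.
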